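(* Consider the singular fractional order system $E\mathscr{D}^\alpha x(t)=Ax(t)+Bu(t)$, $y(t)=Cx(t)$, with the observer based controller $E\mathscr{D}^\alpha \hat x(t)=A\hat x(t)+Bu(t)+L[C\hat x(t)-y(t)]$, $u(t)=K\hat x(t)$. The resulting closed-loop (augmented) system $\bar E\mathscr{D}^\alpha \bar x(t)=\bar A\bar x(t)$, where $\bar E=\mathrm{diag}(E,E)$, $\bar x(t)=\begin{bmatrix}x(t)\\ x(t)-\hat x(t)\end{bmatrix}$ and $\bar A=\begin{bmatrix}A+BK & -BK\\ 0 & A+LC\end{bmatrix}$, is admissible if and only if there exist matrices $P_1,P_2\in\mathbb{P}_\alpha^{n\times n}$, $Q_1\in\mathbb{R}^{(n-r)\times n}$, $Q_2\in\mathbb{R}^{n\times(n-r)}$, $R_1\in\mathbb{R}^{m\times n}$ and $R_2\in\mathbb{R}^{n\times p}$ such that \[ \mathrm{sym}\big(AP_1E^{\rm T}+AE_1Q_1+BR_1\big)<0, \qquad \mathrm{sym}\big(E^{\rm T}P_2A+Q_2E_2A+R_2C\big)<0, \] where $E_1\in\mathbb{R}^{n\times(n-r)}$, $E_2\in\mathbb{R}^{(n-r)\times n}$, $\mathrm{rank}(E_1)=\mathrm{rank}(E_2)=n-r$, $EE_1=0$, $E_2E=0$; the desired gains are then given by \[ K=R_1\big(P_1E^{\rm T}+E_1Q_1\big)^{-1},\qquad L=\big(E^{\rm T}P_2+Q_2E_2\big)^{-1}R_2 . \]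
   Context: Here $x(t)\in\mathbb{R}^n$, $u(t)\in\mathbb{R}^m$, $y(t)\in\mathbb{R}^p$, $\hat x(t)\in\mathbb{R}^n$, $L\in\mathbb{R}^{n\times p}$, $K\in\mathbb{R}^{m\times n}$; $E\in\mathbb{R}^{n\times n}$ is singular with $\mathrm{rank}(E)=r<n$; $\mathscr{D}^\alpha$ is the Caputo fractional derivative of commensurate order $\alpha\in(0,1)$ (the underlying admissibility criteria are stated for $0<\alpha<1$). $\mathrm{sym}(M)=M^{\rm T}+M$. The pair $\{E,A\}$ (system $E\mathscr{D}^\alpha x=Ax$) is admissible if it is regular ($\det(sE-A)\not\equiv0$), impulse free ($\deg\det(sE-A)=\mathrm{rank}(E)$), and stable (all finite roots of $\det(\lambda E-A)=0$ satisfy $|\arg\lambda|>\alpha\pi/2$). The fractional order positive definite matrix set is $\mathbb{P}_\alpha^{n\times n}=\{\sin(\tfrac{\alpha\pi}{2})X+\cos(\tfrac{\alpha\pi}{2})Y: X,Y\in\mathbb{R}^{n\times n},\ \begin{bmatrix}X&Y\\-Y&X\end{bmatrix}>0\}$.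
   Formalization: The gain formulas are asserted for those feasible solutions for which P1 E^T + E1 Q1 and E^T P2 + Q2 E2 are invertible, which the inequalities do not imply; the equivalence is for the existence of gains K, L making the closed loop admissible. *)

(* Defs.v *)
From HB Require Import structures.
From mathcomp Require Import all_boot all_order all_algebra.
From mathcomp Require Import all_classical all_reals.
From mathcomp Require Import exp trigo.
From mathcomp Require Import complex.

Set Implicit Arguments.
Unset Strict Implicit.
Unset Printing Implicit Defensive.

Import Order.TTheory GRing.Theory Num.Theory.
Local Open Scope ring_scope.

Section Defs.
Variable R : realType.

Definition msym (n : nat) (M : 'M[R]_n) : 'M[R]_n := M^T + M.

Definition posdef (n : nat) (M : 'M[R]_n) : Prop :=
  M^T = M /\ forall v : 'cV[R]_n, v != 0 -> 0 < (v^T *m M *m v) 0 0.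
Definition negdef (n : nat) (M : 'M[R]_n) : Prop :=
  M^T = M /\ forall v : 'cV[R]_n, v != 0 -> (v^T *m M *m v) 0 0 < 0.

Definition Palpha (alpha : R) (n : nat) (P : 'M[R]_n) : Prop :=
  exists X Y : 'M[R]_n,
    posdef (block_mx X Y (- Y) X) /\
    P = sin (alpha * pi / 2) *: X + cos (alpha * pi / 2) *: Y.

Definition pencil_det (n : nat) (E A : 'M[R]_n) : {poly R} :=
  \det ('X *: map_mx polyC E - map_mx polyC A).

Definition regular (n : nat) (E A : 'M[R]_n) : Prop := pencil_det E A != 0.

Definition impulse_free (n : nat) (E A : 'M[R]_n) : Prop :=
  (size (pencil_det E A)).-1 = \rank E.

Definition cmod (z : R[i]) : R := Num.sqrt (complex.Re z ^+ 2 + complex.Im z ^+ 2).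

Definition is_arg (z : R[i]) (phi : R) : Prop :=
  z != 0 /\ - pi < phi <= pi /\
  complex.Re z = cmod z * cos phi /\ complex.Im z = cmod z * sin phi.

(* |arg z| > alpha pi / 2 (z = 0 has no argument and is not allowed) *)
Definition arg_gt (alpha : R) (z : R[i]) : Prop :=
  exists phi, is_arg z phi /\ alpha * pi / 2 < `|phi|.

Definition frac_stable (alpha : R) (n : nat) (E A : 'M[R]_n) : Prop :=
  forall z : R[i], root (map_poly (real_complex R) (pencil_det E A)) z ->
    arg_gt alpha z.

Definition admissible (alpha : R) (n : nat) (E A : 'M[R]_n) : Prop :=
  regular E A /\ impulse_free E A /\ frac_stable alpha E A.

End Defs.

(* Main.v *)
(* Write [s = sin (alpha pi / 2)] and [c = cos (alpha pi / 2)]; the stability sector is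
   [Re z * s < |Im z| * c].  The closed-loop pencil is block triangular, so it is
   admissible iff both [(E, A + B K)] and [(E, A + L C)] are, and transposition turns the
   observer problem into the state-feedback one.  For one pair the claim is that
   admissibility amounts to [sym (A W) < 0] for some [W = P E^T + E1 Q].

   Sufficiency: for a complex left eigenvector [v] of the pencil, [E W = E P E^T] turns
   the form of [A W] at [v] into [Re (z * w^* P w)] with [w = E^T v^*], which cannot be
   negative outside the sector; and left null vectors of [E] see only [E1 Q], which forces
   the block of [A] deciding the degree of [det (z E - A)] to be invertible.

   Necessity: in the normal form [E = diag (1, 0)], [A = diag (A1, D)] it remains to find
   [P] in the fractional cone with [sym (A1 P) < 0].  This goes by induction, splitting
   off a real invariant subspace of dimension 1 or 2, where [P] is explicit.

   For the gains [W] must be invertible: on the line from [Q] to [E2] the determinant of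
   [W] is a nonzero polynomial, so a small step makes [W] invertible and keeps the strict
   inequality. *)

Require Import Defs.
From HB Require Import structures.
From mathcomp Require Import all_boot all_order all_algebra.
From mathcomp Require Import all_classical all_reals.
From mathcomp Require Import exp trigo.
From mathcomp Require Import complex.
From mathcomp Require Import perm zify ring lra.
Import Order.TTheory GRing.Theory Num.Theory.
Local Open Scope ring_scope.

Set Implicit Arguments.
Unset Strict Implicit.
Unset Printing Implicit Defensive.

(** * Bilinear forms and positive definite matrices *)

Definition bil (R : realType) (m n : nat) (M : 'M[R]_(m, n))
  (x : 'cV[R]_m) (y : 'cV[R]_n) : R := (x^T *m M *m y) 0 0.

Lemma bilDmx (R : realType) (m n : nat) (M N : 'M[R]_(m, n)) x y :
  bil (M + N) x y = bil M x y + bil N x y.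
Proof. by rewrite /bil mulmxDr mulmxDl mxE. Qed.

Lemma bilNmx (R : realType) (m n : nat) (M : 'M[R]_(m, n)) x y :
  bil (- M) x y = - bil M x y.
Proof. by rewrite /bil mulmxN mulNmx mxE. Qed.

Lemma bilZmx (R : realType) (m n : nat) a (M : 'M[R]_(m, n)) x y :
  bil (a *: M) x y = a * bil M x y.
Proof. by rewrite /bil -scalemxAr -scalemxAl mxE. Qed.

Lemma bil0mx (R : realType) (m n : nat) x y : bil (0 : 'M[R]_(m, n)) x y = 0.
Proof. by rewrite /bil mulmx0 mul0mx mxE. Qed.

Lemma bilDl (R : realType) (m n : nat) (M : 'M[R]_(m, n)) x x' y :
  bil M (x + x') y = bil M x y + bil M x' y.
Proof. by rewrite /bil linearD /= !mulmxDl mxE. Qed.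

Lemma bilDr (R : realType) (m n : nat) (M : 'M[R]_(m, n)) x y y' :
  bil M x (y + y') = bil M x y + bil M x y'.
Proof. by rewrite /bil mulmxDr mxE. Qed.

Lemma bilZl (R : realType) (m n : nat) (M : 'M[R]_(m, n)) a x y :
  bil M (a *: x) y = a * bil M x y.
Proof. by rewrite /bil linearZ /= -!scalemxAl mxE. Qed.

Lemma bilZr (R : realType) (m n : nat) (M : 'M[R]_(m, n)) a x y :
  bil M x (a *: y) = a * bil M x y.
Proof. by rewrite /bil -scalemxAr mxE. Qed.

Lemma bil0r (R : realType) (m n : nat) (M : 'M[R]_(m, n)) x : bil M x 0 = 0.
Proof. by rewrite /bil mulmx0 mxE. Qed.

Lemma bil_tr (R : realType) (m n : nat) (M : 'M[R]_(m, n)) x y :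
  bil M^T y x = bil M x y.
Proof.
rewrite /bil; have -> : y^T *m M^T *m x = (x^T *m M *m y)^T.
  by rewrite !trmx_mul trmxK -mulmxA.
by rewrite mxE.
Qed.

Lemma bil_mulmx (R : realType) (m n p q : nat) (S : 'M[R]_(m, p))
    (M : 'M[R]_(m, n)) (T : 'M[R]_(n, q)) x y :
  bil (S^T *m M *m T) x y = bil M (S *m x) (T *m y).
Proof. by rewrite /bil trmx_mul -!mulmxA. Qed.

Lemma bil_block (R : realType) (m1 m2 n1 n2 : nat) (A : 'M[R]_(m1, n1)) B C
    (D : 'M[R]_(m2, n2)) x1 x2 y1 y2 :
  bil (block_mx A B C D) (col_mx x1 x2) (col_mx y1 y2) =
  bil A x1 y1 + bil B x1 y2 + (bil C x2 y1 + bil D x2 y2).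
Proof.
rewrite /bil -mulmxA mul_block_col tr_col_mx mul_row_col.
have mxD (M N : 'M[R]_1) : (M + N) 0 0 = M 0 0 + N 0 0 by rewrite mxE.
by rewrite !mulmxDr !mulmxA !mxD.
Qed.

Lemma bil1_gt0 (R : realType) (n : nat) (x : 'cV[R]_n) :
  x != 0 -> 0 < bil 1%:M x x.
Proof.
move=> x0; have bE : bil 1%:M x x = \sum_i x i 0 ^+ 2.
  by rewrite /bil mulmx1 mxE; apply: eq_bigr => i _; rewrite mxE.
rewrite lt0r bE sumr_ge0 ?andbT => [|i _]; last exact: sqr_ge0.
apply: contra x0; rewrite psumr_eq0 => [/allP x0|i _]; last exact: sqr_ge0.
apply/eqP/colP => i; rewrite mxE; apply/eqP; rewrite -sqrf_eq0.
exact: x0 (mem_index_enum i).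
Qed.

Lemma bil_self_sym (R : realType) (n : nat) (M : 'M[R]_n) x y :
  M^T = M -> bil M x y = bil M y x.
Proof. by move=> Ms; rewrite -{1}Ms bil_tr. Qed.

Lemma bil_self_asym (R : realType) (n : nat) (M : 'M[R]_n) x y :
  M^T = - M -> bil M x y = - bil M y x.
Proof. by move=> Ms; rewrite -bil_tr Ms bilNmx. Qed.

Lemma negdef_msym (R : realType) (n : nat) (M : 'M[R]_n) :
  negdef (msym M) <-> forall x, x != 0 -> bil M x x < 0.
Proof.
have E x : (x^T *m msym M *m x) 0 0 = 2 * bil M x x.
  by rewrite -/(bil _ _ _) bilDmx bil_tr mulr2n mulrDl mul1r.
split=> [[_ neg] x /neg|neg]; first by rewrite E pmulr_rlt0.
split=> [|x /neg]; first by rewrite /msym linearD /= trmxK addrC.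
by rewrite E pmulr_rlt0.
Qed.

Lemma negdef_msym_congr (R : realType) (n : nat) (U M : 'M[R]_n) :
  U \in unitmx -> negdef (msym M) -> negdef (msym (U *m M *m U^T)).
Proof.
move=> Uu /negdef_msym neg; apply/negdef_msym => x x0.
rewrite -{1}[U]trmxK bil_mulmx; apply: neg; apply: contra x0 => /eqP x0.
have UTu : U^T \in unitmx by rewrite unitmx_tr.
by rewrite -[x](mulKmx UTu) x0 mulmx0.
Qed.

Lemma CauchySchwarz_posdef (R : realType) (n : nat) (M : 'M[R]_n) x y :
  posdef M -> bil M x y ^+ 2 <= bil M x x * bil M y y.
Proof.
move=> [Ms pos]; have [->|y0] := eqVneq y 0; first by rewrite !bil0r expr0n mulr0.
have nng z : 0 <= bil M z z.
  by have [->|/pos/ltW//] := eqVneq z 0; rewrite bil0r.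
have yy : 0 < bil M y y by exact: pos.
(* Writing [<x,y>] for [bil M x y], the form at this vector is [<y,y>] times
   [<x,x> <y,y> - <x,y>^2]. *)
have := nng (bil M y y *: x - bil M x y *: y).
rewrite -scaleNr bilDl !bilDr !bilZl !bilZr (bil_self_sym y x Ms).
set a := bil M y y in yy *; set b := bil M x y; set c := bil M x x => H.
rewrite -(ler_pM2l yy) -subr_ge0; move: H; congr (0 <= _); ring.
Qed.

Lemma posdef_unitmx (R : realType) (n : nat) (M : 'M[R]_n) :
  posdef M -> M \in unitmx.
Proof.
move=> [_ pos]; rewrite unitmxE unitfE; apply/negP => /det0P[v v0 vM].
have: v^T != 0 by rewrite -trmx0 (inj_eq trmx_inj).
by move=> /pos; rewrite trmxK vM mul0mx mxE ltxx.
Qed.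

(* Cauchy-Schwarz against [y = M^-1 e_i] bounds every [x_i ^+ 2] by a multiple of the
   form of [M]. *)
Lemma posdef_dominates (R : realType) (n : nat) (M S : 'M[R]_n) :
  posdef M -> exists2 C, 0 <= C & forall x, `|bil S x x| <= C * bil M x x.
Proof.
move=> Mpos; have Mu := posdef_unitmx Mpos.
pose e (i : 'I_n) : 'cV[R]_n := invmx M *m delta_mx i 0.
pose k i := bil M (e i) (e i).
have nng z : 0 <= bil M z z.
  by case: Mpos => _ pos; have [->|/pos/ltW//] := eqVneq z 0; rewrite bil0r.
have coord i (x : 'cV[R]_n) : x i 0 ^+ 2 <= k i * bil M x x.
  rewrite mulrC; apply: le_trans (CauchySchwarz_posdef x (e i) Mpos).
  rewrite /bil -mulmxA mulKVmx //.
  by rewrite -colE !mxE lexx.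
exists (\sum_i \sum_j `|S i j| * (k i + k j)).
  by do 2![apply: sumr_ge0 => ? _]; rewrite mulr_ge0 ?addr_ge0 ?nng.
move=> x; have -> : bil S x x = \sum_i \sum_j x i 0 * S i j * x j 0.
  rewrite /bil mxE exchange_big /=; apply: eq_bigr => j _.
  by rewrite mxE mulr_suml; apply: eq_bigr => i _; rewrite mxE.
rewrite mulr_suml; apply: le_trans (ler_norm_sum _ _ _) (ler_sum _ _) => i _.
rewrite mulr_suml; apply: le_trans (ler_norm_sum _ _ _) (ler_sum _ _) => j _.
rewrite !normrM (mulrC `|x i 0|) -!mulrA; apply: ler_wpM2l => //.
have := coord i x; have := coord j x.
rewrite -[x i 0 ^+ 2]real_normK ?num_real //
  -[x j 0 ^+ 2]real_normK ?num_real //.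
set a := `|x i 0|; set b := `|x j 0| => bj ai.
have := sqr_ge0 (a - b); have := sqr_ge0 a; have := sqr_ge0 b; lra.
Qed.

(** [posdef_dominates] bounds the form of [S] by [C] times that of [M], so a step below
    [1 / (C + 1)] cannot cancel it; the added 1 covers [C = 0]. *)
Lemma posdef_perturb (R : realType) (n : nat) (M S : 'M[R]_n) :
  posdef M -> S^T = S ->
  exists2 e : R, 0 < e & forall t, 0 < t < e -> posdef (M + t *: S).
Proof.
move=> Mpos Ss; have [C C0 domS] := posdef_dominates S Mpos.
have C1 : 0 < C + 1 by lra.
exists (C + 1)^-1 => [|t /andP[t0 te]]; first by rewrite invr_gt0.
case: Mpos => Ms pos; split=> [|x x0]; first by rewrite linearD linearZ /= Ms Ss.
rewrite -/(bil _ _ _) bilDmx bilZmx.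
have q0 : 0 < bil M x x := pos x x0.
have tC : t * (C + 1) < 1 by rewrite -ltr_pdivlMr // div1r.
have /ler_normlP[] := domS x; rewrite lerNl => Sx _.
have := ler_wpM2l (ltW t0) Sx; nra.
Qed.

Lemma posdef_congr (R : realType) (n : nat) (U M : 'M[R]_n) :
  U \in unitmx -> posdef M -> posdef (U^T *m M *m U).
Proof.
move=> Uu [Ms pos]; split=> [|x x0]; first by rewrite !trmx_mul trmxK Ms mulmxA.
rewrite -/(bil _ _ _) bil_mulmx; apply: pos; apply: contra x0 => /eqP x0.
by rewrite -[x](mulKmx Uu) x0 mulmx0.
Qed.

Lemma col_mx_neq0 (R : realType) (m n : nat) (x : 'cV[R]_m) (y : 'cV[R]_n) :
  (col_mx x y != 0) = (x != 0) || (y != 0).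
Proof. by rewrite col_mx_eq0 negb_and. Qed.

(** Block elimination: the matrix is congruent, through a unit upper triangular one, to the block
    diagonal of [A] and its Schur complement. *)
Lemma posdef_Schur (R : realType) (m n : nat) (A : 'M[R]_m) (B : 'M[R]_(m, n))
    (D : 'M[R]_n) :
  posdef A -> posdef (D - B^T *m invmx A *m B) -> posdef (block_mx A B B^T D).
Proof.
move=> Apos [Ss Spos]; have Au := posdef_unitmx Apos; case: Apos => As Apos.
have -> : block_mx A B B^T D = (block_mx 1%:M (invmx A *m B) 0 1%:M)^T *m
    block_mx A 0 0 (D - B^T *m invmx A *m B) *m block_mx 1%:M (invmx A *m B) 0 1%:M.
  rewrite tr_block_mx !mulmx_block !trmx1 !trmx0 trmx_mul trmx_inv As.
  rewrite !(mul1mx, mulmx1, mul0mx, mulmx0, addr0, add0r) mulmxKV // mulKVmx //.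
  by rewrite !mulmxA addrC subrK.
apply: posdef_congr; first by rewrite unitmxE det_ublock !det1 mulr1 unitr1.
split=> [|x]; first by rewrite tr_block_mx !trmx0 As Ss.
rewrite -[x]vsubmxK col_mx_neq0 -/(bil _ _ _) bil_block !bil0mx addr0 add0r.
have [->|/Apos x0] := eqVneq (usubmx x) 0; rewrite ?bil0r ?add0r /=.
  by move=> /Spos.
move=> _; have [->|/Spos y0] := eqVneq (dsubmx x) 0; rewrite ?bil0r ?addr0 //.
exact: addr_gt0.
Qed.

(** * The fractional positive definite cone *)

(* [X + i Y] is Hermitian positive definite; the form of the condition below is that
   of [X + i Y] at the complex vector [x - i y]. *)
Lemma posdef_hermP (R : realType) (n : nat) (X Y : 'M[R]_n) :
  posdef (block_mx X Y (- Y) X) <->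
  [/\ X^T = X, Y^T = - Y & forall x y, (x != 0) || (y != 0) ->
     0 < bil X x x + bil X y y + 2 * bil Y x y].
Proof.
have E x y : Y^T = - Y -> bil (block_mx X Y (- Y) X) (col_mx x y) (col_mx x y)
    = bil X x x + bil X y y + 2 * bil Y x y.
  move=> Ya; rewrite bil_block bilNmx -(bil_self_asym x y Ya); ring.
split=> [[]|[Xs Ya pos]].
  rewrite tr_block_mx => /eq_block_mx[Xs _ Ya _] pos.
  by split=> // x y; rewrite -col_mx_neq0 -E // => /pos.
split=> [|x]; first by rewrite tr_block_mx Xs linearN /= Ya opprK.
by rewrite -[x]vsubmxK col_mx_neq0 -/(bil _ _ _) E // => /pos.
Qed.

(** [Palpha] with the sine and cosine abstracted to [s] and [c], convertible to it at these values;
    the arguments about the cone use only the signs of [s] and [c]. *)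
Definition fposdef (R : realType) (s c : R) (n : nat) (P : 'M[R]_n) : Prop :=
  exists X Y, posdef (block_mx X Y (- Y) X) /\ P = s *: X + c *: Y.

Lemma fposdef_congr (R : realType) (s c : R) (n : nat) (U P : 'M[R]_n) :
  U \in unitmx -> fposdef s c P -> fposdef s c (U *m P *m U^T).
Proof.
move=> Uu [X [Y [/posdef_hermP[Xs Ya pos] ->]]].
exists (U *m X *m U^T), (U *m Y *m U^T); split; last first.
  by rewrite mulmxDr mulmxDl -!scalemxAr -!scalemxAl.
apply/posdef_hermP; split; rewrite ?trmx_mul ?trmxK ?Xs ?Ya ?mulmxA //.
  by rewrite mulmxN mulNmx.
have UTu : U^T \in unitmx by rewrite unitmx_tr.
have U0 x : (U^T *m x == 0) = (x == 0).
  by apply/eqP/eqP=> [x0|->]; rewrite ?mulmx0 // -[x](mulKmx UTu) x0 mulmx0.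
move=> x y xy; rewrite -{1 3 5}[U]trmxK !bil_mulmx; apply: pos.
by rewrite !U0.
Qed.

Lemma fposdef_scale (R : realType) (s c t : R) (n : nat) (P : 'M[R]_n) :
  0 < t -> fposdef s c P -> fposdef s c (t *: P).
Proof.
move=> t0 [X [Y [/posdef_hermP[Xs Ya pos] ->]]].
exists (t *: X), (t *: Y); split; last by rewrite scalerDr !scalerA !(mulrC t).
apply/posdef_hermP; split; rewrite ?linearZ /= ?Xs ?Ya ?scalerN //.
move=> x y /pos; rewrite !bilZmx mulrCA -!mulrDr; exact: mulr_gt0.
Qed.

Lemma fposdef_diag (R : realType) (s c : R) (m n : nat) (P : 'M[R]_m) (Q : 'M[R]_n) :
  fposdef s c P -> fposdef s c Q -> fposdef s c (block_mx P 0 0 Q).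
Proof.
move=> [X [Y [/posdef_hermP[Xs Ya pos] ->]]].
move=> [X' [Y' [/posdef_hermP[Xs' Ya' pos'] ->]]].
exists (block_mx X 0 0 X'), (block_mx Y 0 0 Y'); split; last first.
  by rewrite !scale_block_mx add_block_mx !scaler0 !addr0.
apply/posdef_hermP; split; rewrite ?tr_block_mx ?trmx0 ?Xs ?Ya ?Xs' ?Ya' //.
  by rewrite opp_block_mx !oppr0.
move=> x y; rewrite -[x]vsubmxK -[y]vsubmxK !col_mx_neq0 !bil_block !bil0mx.
rewrite !addr0 !add0r => xy.
have ge0 : 0 <= bil X (usubmx x) (usubmx x) + bil X (usubmx y) (usubmx y)
               + 2 * bil Y (usubmx x) (usubmx y).
  have [xy1|] := boolP ((usubmx x != 0) || (usubmx y != 0)); first exact/ltW/pos.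
  by rewrite negb_or !negbK => /andP[/eqP-> /eqP->]; rewrite !bil0r mulr0 !addr0.
have ge0' : 0 <= bil X' (dsubmx x) (dsubmx x) + bil X' (dsubmx y) (dsubmx y)
               + 2 * bil Y' (dsubmx x) (dsubmx y).
  have [xy1|] := boolP ((dsubmx x != 0) || (dsubmx y != 0)); first exact/ltW/pos'.
  by rewrite negb_or !negbK => /andP[/eqP-> /eqP->]; rewrite !bil0r mulr0 !addr0.
move: xy; rewrite orbACA => /orP[/pos|/pos']; lra.
Qed.

Lemma fposdef1 (R : realType) (s c : R) (n : nat) :
  0 < s -> fposdef s c (1%:M : 'M[R]_n).
Proof.
move=> s0; exists (s^-1)%:M, 0; split; last first.
  by rewrite scaler0 addr0 scale_scalar_mx divff ?gt_eqF.
apply/posdef_hermP; split; rewrite ?tr_scalar_mx ?trmx0 ?oppr0 //.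
move=> x y xy; rewrite bil0mx mulr0 addr0 -[_%:M]scalemx1 !bilZmx -mulrDr.
have ge0 (z : 'cV[R]_n) : 0 <= bil 1%:M z z.
  by have [->|/bil1_gt0/ltW//] := eqVneq z 0; rewrite bil0r.
apply: mulr_gt0; first by rewrite invr_gt0.
have := ge0 x; have := ge0 y; case/orP: xy => /bil1_gt0; lra.
Qed.

(** Transposition replaces [Y] by [- Y], which amounts to exchanging [x] and [y] in the form of
    [posdef_hermP]. It serves to pass from the observer to state feedback. *)
Lemma fposdef_tr (R : realType) (s c : R) (n : nat) (P : 'M[R]_n) :
  fposdef s c P -> fposdef s c P^T.
Proof.
move=> [X [Y [/posdef_hermP[Xs Ya pos] ->]]].
exists X, (- Y); split; last by rewrite linearD !linearZ /= Xs Ya.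
apply/posdef_hermP; split; rewrite ?linearN /= ?Ya // => x y xy.
by rewrite bilNmx -(bil_self_asym y x Ya) [bil X x x + _]addrC pos // orbC.
Qed.

(** The skew part [Y] vanishes on the diagonal, which leaves [s] times the form of [X]. *)
Lemma fposdef_bil_gt0 (R : realType) (s c : R) (n : nat) (P : 'M[R]_n) x :
  0 < s -> fposdef s c P -> x != 0 -> 0 < bil P x x.
Proof.
move=> s0 [X [Y [/posdef_hermP[Xs Ya pos] ->]]] x0.
have := pos x 0; rewrite x0 !bil0r => /(_ isT) Xx.
have := bil_self_asym x x Ya; rewrite bilDmx !bilZmx => Yx.
have -> : bil Y x x = 0 by lra.
by rewrite mulr0 addr0 mulr_gt0 //; lra.
Qed.

(** * Determinants of pencils *)

Lemma coefM_top (F : nzRingType) (p q : {poly F}) (a b : nat) :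
  (size p <= a.+1)%N -> (size q <= b.+1)%N -> (p * q)`_(a + b) = p`_a * q`_b.
Proof.
move=> pa qb; rewrite coefM; have ia : (a < (a + b).+1)%N by rewrite ltnS leq_addr.
rewrite (bigD1 (Ordinal ia)) //= addKn big1 ?addr0 // => i /eqP ne_ia.
have [lt_ia|lt_ai|eq_ia] := ltngtP i a; last by case: ne_ia; apply: val_inj.
  by rewrite [q`_ _]nth_default ?mulr0 // (leq_trans qb) // ltn_subRL ltn_add2r.
by rewrite [p`_ _]nth_default ?mul0r // (leq_trans pa).
Qed.

Lemma prod_coef_top (F : comNzRingType) (I : Type) (s : seq I) (p : I -> {poly F})
    (d : I -> nat) :
  (forall i, size (p i) <= (d i).+1)%N ->
  (size (\prod_(i <- s) p i)%R <= (\sum_(i <- s) d i).+1)%N /\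
  (\prod_(i <- s) p i)`_(\sum_(i <- s) d i)%N = \prod_(i <- s) (p i)`_(d i).
Proof.
move=> pd; elim: s => [|i s [IHs IHc]]; first by rewrite !big_nil size_poly1 coef1.
rewrite !big_cons coefM_top // IHc; split=> //.
apply: leq_trans (size_polyMleq _ _) _.
by rewrite -subn1 leq_subLR add1n -addnS -addSn leq_add.
Qed.

(** Each Leibniz product takes one entry per row, so its degree is at most the sum of the row
    bounds, and its coefficient there is the product of the entries' coefficients at those
    bounds. *)
Lemma det_coef_top (F : comNzRingType) (n : nat) (M : 'M[{poly F}]_n)
    (d : 'I_n -> nat) :
  (forall i j, size (M i j) <= (d i).+1)%N ->
  (size (\det M) <= (\sum_i d i).+1)%N /\
  (\det M)`_(\sum_i d i)%N = \det (\matrix_(i, j) (M i j)`_(d i)).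
Proof.
move=> Md; have top (s : 'S_n) := prod_coef_top (index_enum _)
  (fun i => Md i (s i)).
split.
  apply: leq_trans (size_sum _ _ _) _; apply/bigmax_leqP => s _.
  rewrite mulr_sign; case: ifP => _; rewrite ?size_polyN; exact: (top s).1.
rewrite coef_sum; apply: eq_bigr => s _.
have -> : (-1) ^+ s = ((-1) ^+ s)%:P :> {poly F} by rewrite rmorphXn rmorphN1.
rewrite coefCM (top s).2; congr (_ * _); apply: eq_bigr => i _.
by rewrite mxE.
Qed.

Lemma pencil_det_tr (R : realType) (n : nat) (E A : 'M[R]_n) :
  pencil_det E^T A^T = pencil_det E A.
Proof. by rewrite /pencil_det -!map_trmx -linearZ -linearB det_tr. Qed.

Lemma pencil_det_mul (R : realType) (n : nat) (U V E A : 'M[R]_n) :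
  pencil_det (U *m E *m V) (U *m A *m V) = (\det U * \det V)%:P * pencil_det E A.
Proof.
rewrite /pencil_det !map_mxM scalemxAl scalemxAr -mulmxBl -mulmxBr !det_mulmx.
by rewrite !det_map_mx polyCM mulrAC.
Qed.

Lemma pencil_det_ublock (R : realType) (m n : nat) (E1 A1 : 'M[R]_m)
    (E2 A2 : 'M[R]_n) B :
  pencil_det (block_mx E1 0 0 E2) (block_mx A1 B 0 A2) =
  pencil_det E1 A1 * pencil_det E2 A2.
Proof.
rewrite /pencil_det !map_block_mx !map_mx0 scale_block_mx !scaler0.
by rewrite opp_block_mx add_block_mx oppr0 addr0 det_ublock.
Qed.

Lemma pencil_det_horner (R : realType) (n : nat) (E A : 'M[R]_n) t :
  (pencil_det E A).[t] = \det (t *: E - A).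
Proof.
rewrite -horner_evalE -det_map_mx; congr (\det _); apply/matrixP => i j.
by rewrite !mxE /= ?horner_evalE !hornerE.
Qed.

(** Apply [det_coef_top] with row bound 1 on the first [r] rows and 0 below: the top coefficients
    form a lower block triangular matrix with diagonal blocks [1] and [- A22]. *)
Lemma pencil_det_pid (R : realType) (r k : nat) A11 A12 A21 (A22 : 'M[R]_k) :
  let p := pencil_det (block_mx (1%:M : 'M_r) 0 0 0) (block_mx A11 A12 A21 A22) in
  (size p <= r.+1)%N /\ p`_r = \det (- A22).
Proof.
move=> p; pose d (i : 'I_(r + k)) : nat := (i < r)%N.
have sd : (\sum_i d i)%N = r.
  rewrite big_split_ord /= [X in (X + _)%N](eq_bigr (fun=> 1%N)) => [|i _]; last first.
    by rewrite /d /= ltn_ord.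
  rewrite [X in (_ + X)%N]big1 => [|i _]; last by rewrite /d /= ltnNge leq_addr.
  by rewrite sum1_card card_ord addn0.
rewrite -{1 2}sd {}/p /pencil_det; set M := 'X *: _ - _.
have ME i j : M i j = (block_mx (1%:M : 'M_r) 0 0 0 i j)%:P * 'X +
    (- block_mx A11 A12 A21 A22 i j)%:P by rewrite !mxE mulrC polyCN.
have rowr i j : block_mx (1%:M : 'M[R]_r) 0 0 (0 : 'M_k) (rshift r i) j = 0.
  by have [j' ->|j' ->] := split_ordP j; rewrite ?block_mxEdl ?block_mxEdr mxE.
have dl i : d (lshift k i) = 1%N by rewrite /d /= ltn_ord.
have dr i : d (rshift r i) = 0%N by rewrite /d /= ltnNge leq_addr.
have [i j|szM ->] := @det_coef_top _ _ M d.
  rewrite ME size_MXaddC; case: ifP => // _; rewrite ltnS.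
  have [i' ->|i' ->] := split_ordP i; first by rewrite dl size_polyC_leq1.
  by rewrite dr rowr size_poly0.
split=> //; rewrite -[RHS]mul1r -(det1 R r) -(det_lblock _ (- A21)).
congr (\det _); apply/matrixP => i j; rewrite mxE ME coefD coefMX coefC.
have [i' ->|i' ->] := split_ordP i; rewrite ?dl ?dr /= ?add0r ?addr0 ?coefC.
  by have [j' ->|j' ->] := split_ordP j; rewrite ?block_mxEul ?block_mxEur /= addr0.
by have [j' ->|j' ->] := split_ordP j; rewrite ?block_mxEdl ?block_mxEdr mxE.
Qed.

(** The dimension is written [r + k] so that the blocks are typed; users first bring [n] to this
    shape by [subst]. *)
Lemma rank_normal_form (F : fieldType) (r k : nat) (E : 'M[F]_(r + k)) :
  \rank E = r ->
  exists U V, [/\ U \in unitmx, V \in unitmx & U *m E *m V = block_mx 1%:M 0 0 0].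
Proof.
move=> rE; exists (invmx (col_ebase E)), (invmx (row_ebase E)).
rewrite !unitmx_inv col_ebase_unit row_ebase_unit; split=> //.
rewrite -{2}[E]mulmx_ebase -!mulmxA mulKmx ?col_ebase_unit //.
by rewrite mulmxV ?row_ebase_unit // mulmx1 rE pid_mx_block.
Qed.

(* With [s = sin t] and [c = cos t], [0 < t < pi / 2], the condition reads [t < |arg z|];
   it excludes [z = 0]. *)
Definition sectorial (R : realType) (s c : R) (n : nat) (E A : 'M[R]_n) : Prop :=
  forall z : R[i], root (map_poly (real_complex R) (pencil_det E A)) z ->
    complex.Re z * s < `|complex.Im z| * c.

(** A root yields a complex left null vector [a + i b] of [z E - A]; the two equations are the real
    and imaginary parts of [v A = z v E]. *)
Lemma root_pencil_det (R : realType) (n : nat) (E A : 'M[R]_n) (z : R[i]) :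
  root (map_poly (real_complex R) (pencil_det E A)) z ->
  exists a b : 'rV[R]_n,
    [/\ (a != 0) || (b != 0),
        a *m A = complex.Re z *: (a *m E) - complex.Im z *: (b *m E) &
        b *m A = complex.Im z *: (a *m E) + complex.Re z *: (b *m E)].
Proof.
pose C := map_mx (real_complex R).
rewrite /pencil_det -det_map_mx rootE -horner_evalE -det_map_mx.
set M := map_mx _ _ => /det0P[v v0 vM].
have ME : M = z *: C _ _ E - C _ _ A.
  apply/matrixP => i j.
  rewrite !mxE /= rmorphB rmorphM /= map_polyX !map_polyC /=.
  by rewrite horner_evalE !hornerE.
pose a := map_mx (@complex.Re R) v; pose b := map_mx (@complex.Im R) v.
have vA : v *m C _ _ A = z *: (v *m C _ _ E).
  by apply/eqP; rewrite eq_sym -subr_eq0 scalemxAr -mulmxBr -ME vM.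
have reC m (N : 'M[R]_(n, m)) : map_mx (@complex.Re R) (v *m C _ _ N) = a *m N.
  apply/matrixP => i j; rewrite !mxE raddf_sum; apply: eq_bigr => l _.
  by rewrite !mxE; case: (v i l) => x y /=; rewrite mulr0 subr0.
have imC m (N : 'M[R]_(n, m)) : map_mx (@complex.Im R) (v *m C _ _ N) = b *m N.
  apply/matrixP => i j; rewrite !mxE raddf_sum; apply: eq_bigr => l _.
  by rewrite !mxE; case: (v i l) => x y /=; rewrite mulr0 add0r.
exists a, b; split.
- apply: contraNT v0; rewrite negb_or !negbK => /andP[/eqP a0 /eqP b0].
  apply/eqP/matrixP => i j; rewrite mxE; apply/eqP; rewrite eq_complex /=.
  move/matrixP/(_ i j): a0; move/matrixP/(_ i j): b0; rewrite !mxE => -> ->.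
  by rewrite eqxx.
- rewrite -reC vA -reC -imC; apply/matrixP => i j; rewrite !mxE.
  by case: z {vA ME M vM} => x y; case: (\sum_k _).
rewrite -imC vA -reC -imC; apply/matrixP => i j; rewrite !mxE.
by case: z {vA ME M vM} => x y; case: (\sum_k _) => u w /=; rewrite addrC.
Qed.

(** * The stability sector *)

Lemma is_arg_exists (R : realType) (z : R[i]) : z != 0 -> exists phi, is_arg z phi.
Proof.
case: z => x y z0; pose r := cmod (x +i* y)%C.
have q0 : 0 < x ^+ 2 + y ^+ 2.
  move: z0; rewrite eq_complex /= negb_and => xy.
  rewrite lt0r addr_ge0 ?sqr_ge0 // andbT paddr_eq0 ?sqr_ge0 // !sqrf_eq0.
  by rewrite negb_and.
have r0 : 0 < r by rewrite sqrtr_gt0.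
have r2 : r ^+ 2 = x ^+ 2 + y ^+ 2 by rewrite sqr_sqrtr // ltW.
have x1 : -1 <= x / r <= 1.
  rewrite -ler_norml normrM normfV (gtr0_norm r0) ler_pdivrMr // mul1r.
  rewrite -(ger0_norm (ltW r0)) -ler_sqr ?nnegrE //.
  by rewrite !real_normK ?num_real // r2 lerDl sqr_ge0.
have [p0 pc] := acos_def x1; set p := acos _ in p0 pc.
have rs : r * sin p = `|y|.
  rewrite sin_acos // -/r; have {1}-> : r = Num.sqrt (r ^+ 2).
    by rewrite sqrtr_sqr ger0_norm ?ltW.
  rewrite -sqrtrM ?sqr_ge0 // -(sqrtr_sqr y); congr Num.sqrt.
  rewrite mulrBr mulr1 expr_div_n [r ^+ 2 * _]mulrC divfK ?sqrf_eq0 ?gt_eqF //.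
  by rewrite r2 addrAC subrr add0r.
have rc : r * cos p = x by rewrite pc mulrC divfK // gt_eqF.
(* [acos (x / r)] has the right cosine; the sign of [y] decides between it and its opposite. *)
have [y0|y0] := lerP 0 y; [exists p | exists (- p)]; split=> //; rewrite ?cosN ?sinN /= -/r.
  rewrite rc rs ger0_norm //; split=> //.
  by have := pi_gt0 R; lra.
rewrite mulrN rc rs ltr0_norm // opprK; split=> //.
(* The range of arguments is open at [- pi], and [p = pi] would make [sin p], hence [y], vanish. *)
rewrite ltrN2 lt_neqAle; have -> : p != pi; last by have := pi_gt0 R; lra.
by apply/eqP => pE; move: rs; rewrite pE sinpi mulr0 ltr0_norm //; lra.
Qed.

(** For an argument [phi] of [z], the inequality says that [sin (|phi| - t)] is positive; as
    [0 < t < pi / 2] and [|phi| <= pi], this sine is positive exactly when [t < |phi|]. At [z = 0]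
    both sides fail. *)
Lemma arg_gtP (R : realType) (alpha : R) (z : R[i]) : 0 < alpha < 1 ->
  arg_gt alpha z <->
  complex.Re z * sin (alpha * pi / 2) < `|complex.Im z| * cos (alpha * pi / 2).
Proof.
move=> /andP[a0 a1]; have pi0 := pi_gt0 R; set t := alpha * pi / 2.
have t0 : 0 < t by rewrite !mulr_gt0 ?invr_gt0.
have tpi : t < pi / 2 by rewrite ltr_pM2r ?invr_gt0 // gtr_pMl.
have argE phi : is_arg z phi ->
    (complex.Re z * sin t < `|complex.Im z| * cos t) = (t < `|phi|).
  move=> [z0 [/andP[phi1 phi2] [-> ->]]].
  have phipi : `|phi| <= pi by rewrite ler_norml phi2 ltW.
  have r0 : 0 < cmod z.
    move: z0; case: (z) => x y; rewrite eq_complex /= negb_and => xy.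
    rewrite sqrtr_gt0 /= lt0r addr_ge0 ?sqr_ge0 // andbT.
    by rewrite paddr_eq0 ?sqr_ge0 // !sqrf_eq0 negb_and.
  have sE : `|sin phi| = sin `|phi|.
    have [p0|p0] := ler0P phi; last by rewrite ger0_norm // sin_ge0_pi // ltW //.
    by rewrite -normrN -sinN ger0_norm // sin_ge0_pi //; lra.
  have cE : cos phi = cos `|phi| by case: ler0P => // _; rewrite cosN.
  rewrite normrM (gtr0_norm r0) sE cE -!mulrA ltr_pM2l // -subr_gt0.
  rewrite [cos `|phi| * _]mulrC [sin `|phi| * _]mulrC.
  rewrite [cos t * _]mulrC [sin t * _]mulrC -sinB.
  have [tphi|tphi] := ltP t `|phi|.
    by apply: sin_gt0_pi; rewrite subr_gt0 tphi /=; lra.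
  apply/negbTE; rewrite -leNgt -oppr_ge0 -sinN opprB; apply: sin_ge0_pi.
  by have := normr_ge0 phi; lra.
split=> [[phi [/[dup] zphi /argE -> //]]|zs].
have [zE|/is_arg_exists[phi zphi]] := eqVneq z 0.
  by move: zs; rewrite zE /= normr0 !mul0r ltxx.
by exists phi; split=> //; rewrite -argE.
Qed.

Lemma frac_stableE (R : realType) (alpha : R) (n : nat) (E A : 'M[R]_n) :
  0 < alpha < 1 ->
  frac_stable alpha E A <->
  sectorial (sin (alpha * pi / 2)) (cos (alpha * pi / 2)) E A.
Proof. by move=> a01; split=> st z /st /(arg_gtP z a01). Qed.

(** * Sufficiency of the matrix inequality *)

Lemma lmi_sectorial (R : realType) (s c : R) (n k : nat) (E A P : 'M[R]_n)
    (E1 : 'M_(n, k)) Q :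
  0 < c -> E *m E1 = 0 -> fposdef s c P ->
  negdef (msym (A *m (P *m E^T + E1 *m Q))) -> sectorial s c E A.
Proof.
move=> c0 EE1 [X [Y [/posdef_hermP[Xs Ya pos] PE]]] /negdef_msym neg z.
case/root_pencil_det=> a [b [ab aA bA]].
set u := complex.Re z in aA bA *; set v := complex.Im z in aA bA *.
pose W := P *m E^T + E1 *m Q; pose f := E^T *m a^T; pose g := E^T *m b^T.
have EW : E *m W = E *m P *m E^T by rewrite mulmxDr !mulmxA EE1 mul0mx addr0.
have formE (x y : 'rV[R]_n) : (x *m (E *m W) *m y^T) 0 0 = bil P (E^T *m x^T) (E^T *m y^T).
  by rewrite -bil_mulmx trmxK EW /bil trmxK.
have mxD (M N : 'M[R]_1) : (M + N) 0 0 = M 0 0 + N 0 0 by rewrite mxE.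
have mxN (M : 'M[R]_1) : (- M) 0 0 = - M 0 0 by rewrite mxE.
have mxZ t (M : 'M[R]_1) : (t *: M) 0 0 = t * M 0 0 by rewrite mxE.
have bilA : bil (A *m W) a^T a^T = u * bil P f f - v * bil P g f.
  rewrite /bil trmxK mulmxA aA !mulmxBl -!scalemxAl mxD mxN !mxZ.
  by rewrite -!(mulmxA _ E W) !formE.
have bilB : bil (A *m W) b^T b^T = v * bil P f g + u * bil P g g.
  rewrite /bil trmxK mulmxA bA !mulmxDl -!scalemxAl mxD !mxZ.
  by rewrite -!(mulmxA _ E W) !formE.
(* This sum is the real part of the Hermitian form of [A W] at the complex vector made of [a] and
   [b]. *)
have lt0 : bil (A *m W) a^T a^T + bil (A *m W) b^T b^T < 0.
  have tr0 (x : 'rV[R]_n) : (x^T == 0) = (x == 0) by rewrite -trmx0 (inj_eq trmx_inj).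
  have le0 x : bil (A *m W) x x <= 0.
    by have [->|/neg/ltW//] := eqVneq x 0; rewrite bil0r.
  have := le0 a^T; have := le0 b^T; case/orP: ab; rewrite -tr0 => /neg; lra.
have Yff := bil_self_asym f f Ya; have Ygg := bil_self_asym g g Ya.
have Ygf := bil_self_asym g f Ya; have Xgf := bil_self_sym g f Xs.
have ge0 x y : 0 <= bil X x x + bil X y y + 2 * bil Y x y.
  have [/pos/ltW//|] := boolP ((x != 0) || (y != 0)).
  by rewrite negb_or !negbK => /andP[/eqP-> /eqP->]; rewrite !bil0r mulr0 !addr0.
have fg := ge0 f g; have gf := ge0 g f.
rewrite ltNge; apply/negP => /= us; move: lt0; rewrite bilA bilB PE !bilDmx !bilZmx.
have -> : bil Y f f = 0 by lra.
have -> : bil Y g g = 0 by lra.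
rewrite Ygf Xgf in gf *; rewrite mulr0 addr0.
set N1 := bil X f f in fg gf *; set N2 := bil X g g in fg gf *.
set w := bil Y f g in fg gf *; set x := bil X f g.
(* Positivity at [(f, g)] and at [(g, f)] gives [|2 w| <= N1 + N2]. The sum in [lt0] is
   [u s (N1 + N2) + 2 c v w], hence nonnegative under [us]: a contradiction. *)
have vw : - (v * (2 * w)) <= `|v| * (N1 + N2).
  rewrite -mulrN; apply: le_trans (ler_norm _) _; rewrite normrM ler_wpM2l //.
  by rewrite ler_norml; apply/andP; split; lra.
have N0 : 0 <= N1 + N2 by lra.
have := ler_wpM2r N0 us; have := ler_wpM2l (ltW c0) vw.
nra.
Qed.

(** * Degree of the pencil determinant and admissibility *)

Lemma size_pencil_det (R : realType) (n : nat) (E A : 'M[R]_n) :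
  (size (pencil_det E A) <= (\rank E).+1)%N.
Proof.
have [r Er] : exists r, \rank E = r by exists (\rank E).
have : n = (r + (n - r))%N by rewrite -Er subnKC ?rank_leq_row.
move: (n - r)%N => k nE; subst n; rewrite Er.
have [U [V [Uu Vu UEV]]] := rank_normal_form Er.
have d0 : \det U * \det V != 0 by rewrite mulf_neq0 // -unitfE -unitmxE.
rewrite -(size_Cmul _ d0) -pencil_det_mul UEV -[U *m A *m V]submxK.
exact: (pencil_det_pid _ _ _ _).1.
Qed.

(** Up to a nonzero factor, the coefficient of degree [r] is the determinant of the lower right
    block. *)
Lemma size_pencil_det_eq (R : realType) (r k : nat) (E A U V : 'M[R]_(r + k)) :
  U \in unitmx -> V \in unitmx -> U *m E *m V = block_mx 1%:M 0 0 0 ->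
  (size (pencil_det E A) == r.+1) = (drsubmx (U *m A *m V) \in unitmx).
Proof.
move=> Uu Vu UEV.
have d0 : \det U * \det V != 0 by rewrite mulf_neq0 // -unitfE -unitmxE.
rewrite -(size_Cmul _ d0) -pencil_det_mul UEV -{1}[U *m A *m V]submxK.
set p := pencil_det _ _; have [szp pr] : (size p <= r.+1)%N /\ _ := pencil_det_pid _ _ _ _.
have -> : (drsubmx (U *m A *m V) \in unitmx) = (p`_r != 0).
  by rewrite pr unitmxE unitfE -scaleN1r detZ mulf_eq0 signr_eq0.
apply/eqP/idP => [sz|pr0].
  have -> : p`_r = lead_coef p by rewrite lead_coefE sz.
  by rewrite lead_coef_eq0 -size_poly_eq0 sz.
by apply/eqP; rewrite eqn_leq szp ltnNge; apply: contra pr0 => /leq_sizeP/(_ r (leqnn _))->.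
Qed.

(** [size] is the degree plus one, and 0 for the zero polynomial, so one equation expresses both
    regularity and absence of impulses. *)
Lemma admissibleE (R : realType) (alpha : R) (n : nat) (E A : 'M[R]_n) :
  admissible alpha E A <->
  size (pencil_det E A) = (\rank E).+1 /\ frac_stable alpha E A.
Proof.
rewrite /admissible /regular /impulse_free -size_poly_gt0.
by split=> [[reg [imp st]]|[sz st]]; [rewrite -imp prednK | rewrite sz].
Qed.

Lemma admissible_tr (R : realType) (alpha : R) (n : nat) (E A : 'M[R]_n) :
  admissible alpha E^T A^T <-> admissible alpha E A.
Proof. by rewrite !admissibleE /frac_stable pencil_det_tr mxrank_tr. Qed.

(** Degrees add in the product of the two determinants, and each is at most its rank; the sum
    reaches the total rank only if both bounds are attained. *)
Lemma admissible_ublock (R : realType) (alpha : R) (m n : nat)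
    (E1 A1 : 'M[R]_m) (E2 A2 : 'M[R]_n) B :
  admissible alpha (block_mx E1 0 0 E2) (block_mx A1 B 0 A2) <->
  admissible alpha E1 A1 /\ admissible alpha E2 A2.
Proof.
have size_top (a b c d : nat) : (a <= c.+1)%N -> (b <= d.+1)%N ->
    (0 < a)%N -> (0 < b)%N -> (a + b).-1 = (c + d).+1 <-> a = c.+1 /\ b = d.+1.
  by clear; lia.
rewrite !admissibleE /frac_stable pencil_det_ublock rank_diag_block_mx rmorphM /=.
move: (pencil_det E1 A1) (pencil_det E2 A2) (size_pencil_det E1 A1)
  (size_pencil_det E2 A2) => p q szp szq.
have [p0|p0] := eqVneq p 0.
  by rewrite p0 mul0r size_poly0; split=> [[]|[[]]].
have [q0|q0] := eqVneq q 0.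
  by rewrite q0 mulr0 size_poly0; split=> [[]|[_ []]].
rewrite size_mul //; have := size_top _ _ _ _ szp szq.
rewrite !size_poly_gt0 => /(_ p0 q0) ->.
split=> [[[szp1 szq1] st]|[[sp stp] [sq stq]]].
  by split; split=> // z rz; apply: st; rewrite rootM rz ?orbT.
by split=> // z; rewrite rootM => /orP[/stp|/stq].
Qed.

(** If the lower right block of [U A V] had a left null vector [v], then [x = (0, v) U] would
    satisfy [x E = 0] and [x A E1 = 0], and the form of [A (P E^T + E1 Q)] would vanish at [x]. *)
Lemma lmi_size_pencil_det (R : realType) (n k : nat) (E A P : 'M[R]_n)
    (E1 : 'M_(n, k)) Q :
  E *m E1 = 0 -> negdef (msym (A *m (P *m E^T + E1 *m Q))) ->
  size (pencil_det E A) = (\rank E).+1.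
Proof.
have [r Er] : exists r, \rank E = r by exists (\rank E).
have : n = (r + (n - r))%N by rewrite -Er subnKC ?rank_leq_row.
move: (n - r)%N => l nE EE1; subst n => /negdef_msym neg.
have [U [V [Uu Vu UEV]]] := rank_normal_form Er.
apply/eqP; rewrite Er (size_pencil_det_eq A Uu Vu UEV) unitmxE unitfE.
apply/negP => /det0P[v v0 vA]; pose x := row_mx 0 v *m U.
have xE : x *m E = 0.
  rewrite -[E](mulmxK Vu) /x !mulmxA -(mulmxA _ U E) -(mulmxA _ (U *m E)) UEV.
  by rewrite mul_row_block !(mulmx0, mul0mx) !addr0 row_mx0 mul0mx.
have [T E1V] : exists T, E1 = V *m col_mx 0 T.
  exists (dsubmx (invmx V *m E1)); rewrite -[LHS](mulKVmx Vu); congr (_ *m _).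
  rewrite -[LHS]vsubmxK; congr (col_mx _ _).
  have : U *m E *m V *m (invmx V *m E1) = 0.
    by rewrite mulmxA mulmxK // -mulmxA EE1 mulmx0.
  rewrite UEV -[X in _ *m X]vsubmxK mul_block_col !mul0mx mul1mx !addr0.
  by move=> /(congr1 usubmx); rewrite col_mxKu linear0.
have xAE1 : x *m A *m E1 = 0.
  rewrite E1V /x !mulmxA -(mulmxA _ U A) -(mulmxA _ (U *m A)) -[U *m A *m V]submxK.
  by rewrite mul_row_block mul_row_col !mul0mx !add0r vA mulmx0 mul0mx addr0.
have x0 : x^T != 0.
  rewrite -trmx0 (inj_eq trmx_inj); apply: contra v0 => /eqP x0.
  have := mulmxK Uu (row_mx 0 v); rewrite -/x x0 mul0mx -row_mx0.
  by case/eq_row_mx => _ <-.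
have := neg _ x0; rewrite /bil trmxK mulmxDr mulmxA mulmxDr mulmxDl.
rewrite -!mulmxA -trmx_mul xE trmx0 !mulmx0 add0r !mulmxA xAE1 !mul0mx mxE.
by rewrite ltxx.
Qed.

Lemma lmi_admissible (R : realType) (alpha : R) (n k : nat) (E A P : 'M[R]_n)
    (E1 : 'M_(n, k)) Q :
  0 < alpha < 1 -> E *m E1 = 0 -> Palpha alpha P ->
  negdef (msym (A *m (P *m E^T + E1 *m Q))) -> admissible alpha E A.
Proof.
move=> a01 EE1 Pa neg; apply/admissibleE; split; first exact: lmi_size_pencil_det neg.
apply/frac_stableE => //; apply: lmi_sectorial EE1 Pa neg; apply: cos_gt0_pihalf.
have := pi_gt0 R; case/andP: a01; nra.
Qed.

(** * The fractional Lyapunov inequality *)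

Lemma negdefN (R : realType) (n : nat) (M : 'M[R]_n) : negdef M <-> posdef (- M).
Proof.
split=> [[Ms neg]|[Ms pos]]; split=> [|x x0].
- by rewrite linearN /= Ms.
- by rewrite -/(bil _ _ _) bilNmx oppr_gt0; apply: neg.
- by apply: oppr_inj; rewrite -linearN.
by rewrite -oppr_gt0 -/(bil _ _ _) -bilNmx; apply: pos.
Qed.

Lemma posdef_scale (R : realType) (n : nat) t (M : 'M[R]_n) :
  0 < t -> posdef M -> posdef (t *: M).
Proof.
move=> t0 [Ms pos]; split=> [|x /pos]; first by rewrite linearZ /= Ms.
by rewrite -!/(bil _ _ _) bilZmx; apply: mulr_gt0.
Qed.

Lemma sectorial_mul (R : realType) (s c : R) (n : nat) (U V E A : 'M[R]_n) :
  U \in unitmx -> V \in unitmx ->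
  sectorial s c E A -> sectorial s c (U *m E *m V) (U *m A *m V).
Proof.
move=> Uu Vu st z; rewrite pencil_det_mul rmorphM /= map_polyC rootM => /orP[|/st//].
have d0 : \det U * \det V != 0 by rewrite mulf_neq0 // -unitfE -unitmxE.
by rewrite rootC fmorph_eq0 (negPf d0).
Qed.

Definition lyapunov_solvable (R : realType) (s c : R) (n : nat) (A : 'M[R]_n) : Prop :=
  exists P, fposdef s c P /\ negdef (msym (A *m P)).

Lemma lyapunov_conj (R : realType) (s c : R) (n : nat) (T A : 'M[R]_n) :
  T \in unitmx -> lyapunov_solvable s c (T *m A *m invmx T) ->
  lyapunov_solvable s c A.
Proof.
move=> Tu [P [Pp neg]]; have iTu : invmx T \in unitmx by rewrite unitmx_inv.
exists (invmx T *m P *m (invmx T)^T); split; first exact: fposdef_congr.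
have -> : A *m (invmx T *m P *m (invmx T)^T) =
    invmx T *m (T *m A *m invmx T *m P) *m (invmx T)^T.
  by rewrite !mulmxA mulVmx // mul1mx.
exact: negdef_msym_congr.
Qed.

(* Scaling the second block of [P] by a large constant absorbs the coupling [B]. *)
Lemma lyapunov_lblock (R : realType) (s c : R) (m n : nat) (A : 'M[R]_m)
    (B : 'M[R]_(n, m)) (D : 'M[R]_n) :
  lyapunov_solvable s c A -> lyapunov_solvable s c D ->
  lyapunov_solvable s c (block_mx A 0 B D).
Proof.
move=> [P [Pp /negdefN AP]] [Q [Qp /negdefN DQ]].
pose N := - (B *m P)^T; have NT : N^T = - (B *m P) by rewrite linearN /= trmxK.
have /posdef_perturb/(_ _) : posdef (- msym (D *m Q)) by [].
move=> /(_ (- (N^T *m invmx (- msym (A *m P)) *m N))) [].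
  by case: (AP) => Ms _; rewrite linearN /= !trmx_mul trmxK trmx_inv Ms mulmxA.
move=> e e0 /(_ (e / 2)); set u := e / 2 => pos.
have u0 : 0 < u by rewrite divr_gt0.
have {pos}pos : posdef (- msym (D *m Q) + u *: - (N^T *m invmx (- msym (A *m P)) *m N)).
  by apply: pos; rewrite u0 /u; lra.
exists (block_mx P 0 0 (u^-1 *: Q)); split.
  by apply: fposdef_diag => //; apply: fposdef_scale; rewrite ?invr_gt0.
apply/negdefN; have -> : - msym (block_mx A 0 B D *m block_mx P 0 0 (u^-1 *: Q)) =
    block_mx (- msym (A *m P)) N N^T (u^-1 *: - msym (D *m Q)).
  rewrite /msym mulmx_block !(mulmx0, mul0mx) !(addr0, add0r) tr_block_mx trmx0.
  rewrite add_block_mx opp_block_mx addr0 add0r -scalemxAr linearZ /= -scalerDr.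
  by rewrite -scalerN NT.
(* Factoring [u^-1] out of the Schur complement leaves the perturbed matrix of [pos]. *)
apply: posdef_Schur => //.
rewrite -[N^T *m _ *m N]scale1r -(mulVf (lt0r_neq0 u0)) -scalerA -scalerBr.
by rewrite -scalerN; apply: posdef_scale; rewrite ?invr_gt0.
Qed.

Lemma lyapunov_scalar (R : realType) (s c mu : R) (n : nat) :
  0 < s -> mu < 0 -> lyapunov_solvable s c (mu%:M : 'M[R]_n).
Proof.
move=> s0 mu0; exists 1%:M; split; first exact: fposdef1.
apply/negdef_msym => x /bil1_gt0 x0.
by rewrite mulmx1 -[_%:M]scalemx1 bilZmx; rewrite nmulr_rlt0.
Qed.

(* Take [P = s X + c Y] with [X = x] and [Y = y J], where [y = - sgn nu]
   and [x > 1] is close to [1]. *)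
Lemma lyapunov_rotation (R : realType) (s c mu nu : R) (n : nat) :
  mu * s < `|nu| * c ->
  lyapunov_solvable s c (block_mx (mu *: 1%:M) (- nu *: 1%:M) (nu *: 1%:M)
                                  (mu *: 1%:M) : 'M[R]_(n + n)).
Proof.
(* [d] is the gap in [mn] divided by more than [|mu s|], so that [mu s (1 + d)] still stays below
   [|nu| c]. *)
move=> mn; pose d := (`|nu| * c - mu * s) / (`|mu * s| + 1).
have d0 : 0 < d by rewrite divr_gt0 ?subr_gt0 // ltr_wpDl.
have dmu : mu * s * (1 + d) < `|nu| * c.
  have := ler_norm (mu * s) => le_mu.
  have dE : d * (`|mu * s| + 1) = `|nu| * c - mu * s.
    by rewrite divfK // gt_eqF // ltr_wpDl.
  nra.
have [y [y2 ynu]] : exists y, y ^+ 2 = 1 /\ nu * y = - `|nu|.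
  have [nu0|nu0] := lerP 0 nu; [exists (-1) | exists 1].
    by rewrite sqrrN expr1n mulrN1 ger0_norm.
  by rewrite expr1n mulr1 ltr0_norm // opprK.
pose I := 1%:M : 'M[R]_n.
pose X := block_mx ((1 + d) *: I) 0 0 ((1 + d) *: I).
pose Y := block_mx 0 (y *: I) (- (y *: I)) 0.
have It : I^T = I by rewrite /I trmx1.
exists (s *: X + c *: Y); split.
  exists X, Y; split=> //; apply/posdef_hermP; split.
  - by rewrite tr_block_mx !trmx0 linearZ /= It.
  - rewrite tr_block_mx !trmx0 [(- _)^T]linearN /= linearZ /= It opp_block_mx.
    by rewrite opprK !oppr0.
  move=> u w; rewrite -[u]vsubmxK -[w]vsubmxK; move: (usubmx u) (dsubmx u).
  move: (usubmx w) (dsubmx w) => w1 w2 u1 u2; rewrite !col_mx_neq0 !bil_block.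
  rewrite !bilNmx !bilZmx !bil0mx !add0r !addr0 => uw.
  have ge0 (x : 'cV[R]_n) : 0 <= bil I x x.
    by have [->|/bil1_gt0/ltW//] := eqVneq x 0; rewrite bil0r.
  (* As [y^2 = 1], the form is the sum of these two squares and of [d] times all four squared
     norms. *)
  have := ge0 (u1 + y *: w2); have := ge0 (u2 - y *: w1).
  rewrite -scaleNr !(bilDl, bilDr, bilZl, bilZr) !mulrA mulrNN -expr2 y2 !mul1r.
  rewrite (bil_self_sym w2 u1 It) (bil_self_sym w1 u2 It).
  have : 0 < d * (bil I u1 u1 + bil I u2 u2 + bil I w1 w1 + bil I w2 w2).
    apply: mulr_gt0 => //.
    have := ge0 u1; have := ge0 u2; have := ge0 w1; have := ge0 w2.
    by move: uw => /orP[]/orP[]/bil1_gt0; rewrite -/I; lra.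
  lra.
apply/negdef_msym => x x0.
have -> : block_mx (mu *: I) (- nu *: I) (nu *: I) (mu *: I) *m (s *: X + c *: Y) =
   block_mx ((mu * s * (1 + d) + c * (nu * y)) *: I) ((mu * c * y - nu * s * (1 + d)) *: I)
            ((nu * s * (1 + d) - mu * c * y) *: I) ((mu * s * (1 + d) + c * (nu * y)) *: I).
  rewrite !scale_block_mx add_block_mx !scaler0 !(add0r, addr0) mulmx_block.
  rewrite -!scaleNr !scalerA -!scalemxAl !mul1mx !scalerA -!scalerDl.
  by congr (block_mx (_ *: _) (_ *: _) (_ *: _) (_ *: _)); ring.
rewrite ynu -[x]vsubmxK bil_block !bilZmx (bil_self_sym (dsubmx x) (usubmx x) It).
have x12 : (usubmx x != 0) || (dsubmx x != 0) by rewrite -col_mx_neq0 vsubmxK.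
have ge0 (v : 'cV[R]_n) : 0 <= bil I v v.
  by have [->|/bil1_gt0/ltW//] := eqVneq v 0; rewrite bil0r.
have gt0 : 0 < bil I (usubmx x) (usubmx x) + bil I (dsubmx x) (dsubmx x).
  have := ge0 (usubmx x); have := ge0 (dsubmx x).
  by case/orP: x12 => /bil1_gt0; rewrite -/I; lra.
set p := bil I (usubmx x) (usubmx x) in gt0 *.
set q := bil I (dsubmx x) (dsubmx x) in gt0 *.
have : (mu * s * (1 + d) + c * - `|nu|) * (p + q) < 0 by rewrite pmulr_llt0 //; lra.
lra.
Qed.

(** [W] is [col_ebase W] times the first [k] rows of the invertible [row_ebase W]; the remaining
    rows complete it. *)
Lemma row_free_completion (F : fieldType) (k l : nat) (W : 'M[F]_(k, k + l)) :
  row_free W -> exists Z, col_mx W Z \in unitmx.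
Proof.
move=> /eqP rW; exists (dsubmx (row_ebase W)).
have -> : col_mx W (dsubmx (row_ebase W)) =
    block_mx (col_ebase W) 0 0 1%:M *m row_ebase W.
  rewrite -[X in _ = _ *m X]vsubmxK mul_block_col !mul0mx addr0 add0r mul1mx.
  congr col_mx; rewrite -{1}[W]mulmx_ebase rW pid_mx_row -{1}[row_ebase W]vsubmxK.
  by rewrite -mulmxA mul_row_col mul1mx mul0mx addr0.
rewrite unitmx_mul row_ebase_unit andbT unitmxE det_ublock det1 mulr1 -unitmxE.
exact: col_ebase_unit.
Qed.

(** The inductive step for both dimensions of the invariant subspace. Completing [W] to a basis
    makes [A] lower block triangular with corner [B], and the determinant of the other block's
    pencil divides that of [A], so its roots stay in the sector. *)
Lemma lyapunov_invariant (R : realType) (s c : R) (n k : nat) (A : 'M[R]_n)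
    (W : 'M_(k, n)) (B : 'M_k) :
  (0 < k)%N -> row_free W -> W *m A = B *m W -> lyapunov_solvable s c B ->
  (forall l, (l < n)%N -> forall D : 'M_l, sectorial s c 1%:M D ->
     lyapunov_solvable s c D) ->
  sectorial s c 1%:M A -> lyapunov_solvable s c A.
Proof.
move=> k0 Wfree WA lB IH st.
have [l nE] : exists l, n = (k + l)%N.
  by exists (n - k)%N; rewrite subnKC // -(eqP Wfree) rank_leq_col.
subst n; have [Z Tu] := row_free_completion Wfree; set T := col_mx W Z in Tu.
apply: (lyapunov_conj Tu); set M := T *m A *m invmx T.
have WT : W *m invmx T = row_mx 1%:M 0.
  have := mulmxV Tu; rewrite mul_col_mx scalar_mx_block block_mxEv.
  by case/eq_col_mx.
have uM : usubmx M = row_mx B 0.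
  rewrite /M !mul_col_mx col_mxKu WA -mulmxA WT mul_mx_row mulmx1 mulmx0 //.
have ME : M = block_mx B 0 (dlsubmx M) (drsubmx M).
  by rewrite -{1}[M]vsubmxK uM block_mxEv hsubmxK.
rewrite ME; apply: lyapunov_lblock => //; apply: IH.
  by rewrite -[X in (X < _)%N]add0n ltn_add2r.
move=> z rz; have iTu : invmx T \in unitmx by rewrite unitmx_inv.
apply: (sectorial_mul Tu iTu st); rewrite mulmx1 mulmxV // -/M ME.
rewrite -pencil_det_tr tr_block_mx trmx1 trmx0 scalar_mx_block pencil_det_ublock.
by rewrite rmorphM rootM /= -{1}(trmx1 R l) pencil_det_tr rz orbT.
Qed.

Lemma lyapunov_fractional (R : realType) (s c : R) (n : nat) (A : 'M[R]_n) :
  0 < s -> 0 < c -> sectorial s c 1%:M A -> lyapunov_solvable s c A.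
Proof.
move=> s0 c0; elim/ltn_ind: n A => -[|n] IH A st.
  exists 0; split; last by apply/negdef_msym => x; rewrite [x]flatmx0 eqxx.
  by have := fposdef1 c 0 s0; rewrite [1%:M]flatmx0.
have [z rz] : exists z, root (map_poly (real_complex R) (pencil_det 1%:M A)) z.
  apply/closed_rootP; rewrite size_map_poly.
  suff -> : pencil_det 1%:M A = char_poly A by rewrite size_char_poly.
  by rewrite /pencil_det map_scalar_mx scale_scalar_mx mulr1.
have [a [b [ab]]] := root_pencil_det rz; rewrite !mulmx1 => aA bA.
have := st z rz; move: aA bA; set mu := complex.Re z; set nu := complex.Im z.
move=> aA bA; have [nu0|nu0] := eqVneq nu 0.
  rewrite nu0 normr0 mul0r pmulr_llt0 // => mu0.
  have [x x0 xA] : exists2 x : 'rV[R]_n.+1, x != 0 & x *m A = mu *: x.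
    case/orP: ab => x0; [exists a | exists b] => //; rewrite ?aA ?bA nu0.
      by rewrite scale0r subr0.
    by rewrite scale0r add0r.
  apply: (@lyapunov_invariant _ _ _ _ _ _ x mu%:M) => //.
  - by rewrite /row_free rank_rV x0.
  - by rewrite xA mul_scalar_mx.
  exact: lyapunov_scalar.
(* For a nonreal root, [a] and [b] span an invariant plane. Its dimension is written [1 + 1] to
   match the blocks of [lyapunov_rotation]. *)
move=> munu; apply: (@lyapunov_invariant _ _ _ _ (1 + 1) _ (col_mx a b)
  (block_mx (mu *: 1%:M) (- nu *: 1%:M) (nu *: 1%:M) (mu *: 1%:M))) => //.
(* Independence of [a] and [b]: applying [A] to [x a + y b = 0] and dividing by [nu] gives
   [y a - x b = 0]; together they give [(x^2 + y^2) a = (x^2 + y^2) b = 0]. *)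
- apply: inj_row_free => v; rewrite -[v]hsubmxK [lsubmx v]mx11_scalar.
  rewrite [rsubmx v]mx11_scalar mul_row_col !mul_scalar_mx.
  set x := lsubmx v 0 0; set y := rsubmx v 0 0 => xy.
  have yx : y *: a - x *: b = 0.
    have := congr1 (mulmx^~ A) xy; rewrite /= mul0mx mulmxDl -!scalemxAl aA bA.
    move/(congr1 (fun w => nu^-1 *: w)); rewrite scaler0.
    have -> : x *: (mu *: a - nu *: b) + y *: (nu *: a + mu *: b) =
        mu *: (x *: a + y *: b) + nu *: (y *: a - x *: b).
      by apply/rowP => i; rewrite !mxE; ring.
    by rewrite xy scaler0 add0r scalerA mulVf // scale1r.
  have xa : (x ^+ 2 + y ^+ 2) *: a = 0.
    have := congr2 (fun u w => x *: u + y *: w) xy yx; rewrite !scaler0 addr0.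
    rewrite !scalerDr !scalerN !scalerA addrACA [y * x]mulrC subrr addr0.
    by rewrite -scalerDl -!expr2.
  have xb : (x ^+ 2 + y ^+ 2) *: b = 0.
    have := congr2 (fun u w => y *: u - x *: w) xy yx; rewrite !scaler0 subr0.
    rewrite !scalerDr !scalerN !scalerA opprD opprK addrACA [y * x]mulrC subrr add0r.
    by rewrite -scalerDl -!expr2 addrC.
  have : x ^+ 2 + y ^+ 2 == 0.
    apply: contraLR ab => xy0; rewrite negb_or !negbK.
    move/eqP: xa; rewrite scaler_eq0 (negPf xy0) /= => ->.
    by move/eqP: xb; rewrite scaler_eq0 (negPf xy0).
  rewrite paddr_eq0 ?sqr_ge0 // !sqrf_eq0 => /andP[/eqP-> /eqP->].
  by rewrite !raddf0 row_mx0.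
- rewrite mul_col_mx mul_block_col aA bA -!scalemxAl !mul1mx scaleNr //.
exact: lyapunov_rotation.
Qed.

(** * Necessity of the matrix inequality for a singular pair *)

(** In the normal form, [P] solves the Lyapunov inequality of the finite block [B], and [Q] is free
    to put [- invmx D] in the other block of [P E^T + E1 Q]; up to congruence the product with [A]
    becomes [diag (B P, -1)]. *)
Lemma admissible_lmi (R : realType) (alpha : R) (n k : nat) (E A : 'M[R]_n)
    (E1 : 'M_(n, k)) :
  0 < alpha < 1 -> n = (\rank E + k)%N -> \rank E1 = k -> E *m E1 = 0 ->
  admissible alpha E A ->
  exists P Q, Palpha alpha P /\ negdef (msym (A *m (P *m E^T + E1 *m Q))).
Proof.
move=> a01; have [r Er] : exists r, \rank E = r by exists (\rank E).
rewrite {1}Er => nE; subst n => rE1 EE1 /admissibleE[szE /(frac_stableE _ _ a01) st].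
have pi0 := pi_gt0 R; have [a0 a1] := andP a01.
have s0 : 0 < sin (alpha * pi / 2) by apply: sin_gt0_pi; nra.
have c0 : 0 < cos (alpha * pi / 2) by apply: cos_gt0_pihalf; nra.
rewrite /Palpha; set s := sin _ in s0 st *; set c := cos _ in c0 st *.
have [U [V [Uu Vu UEV]]] := rank_normal_form Er.
have := size_pencil_det_eq A Uu Vu UEV; rewrite szE Er eqxx => /esym.
set A11 := ulsubmx (U *m A *m V); set A12 := ursubmx (U *m A *m V).
set A21 := dlsubmx (U *m A *m V); set D := drsubmx (U *m A *m V) => Du.
(* [U'] and [V'] clear the off-diagonal blocks [A12] and [A21] with the invertible pivot [D],
   leaving the normal form of [E] unchanged. *)
pose U' := block_mx 1%:M (- (A12 *m invmx D)) 0 1%:M *m U.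
pose V' := V *m block_mx 1%:M 0 (- (invmx D *m A21)) 1%:M.
have Uu' : U' \in unitmx.
  by rewrite unitmx_mul Uu andbT unitmxE det_ublock !det1 mulr1 unitr1.
have Vu' : V' \in unitmx.
  by rewrite unitmx_mul Vu unitmxE det_lblock !det1 mulr1 unitr1.
have UEV' : U' *m E *m V' = block_mx 1%:M 0 0 0.
  rewrite /U' /V' !mulmxA -(mulmxA _ U E) -(mulmxA _ (U *m E)) UEV !mulmx_block.
  by rewrite !(mulmx0, mul0mx, addr0, add0r, mulmx1).
pose B := A11 - A12 *m invmx D *m A21.
have UAV' : U' *m A *m V' = block_mx B 0 0 D.
  rewrite /U' /V' !mulmxA -(mulmxA _ U A) -(mulmxA _ (U *m A)) -[U *m A *m V]submxK.
  rewrite -/A11 -/A12 -/A21 -/D !mulmx_block.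
  rewrite !(mulmx0, mul0mx, addr0, add0r, mulmx1, mul1mx).
  by rewrite !mulNmx mulmxKV // subrr mul0mx addr0 mulmxN mulKVmx // subrr.
clearbody U' V'.
have [P [Pp /negdef_msym neg]] : lyapunov_solvable s c B.
  apply: lyapunov_fractional => // z rz; apply: (sectorial_mul Uu' Vu' st).
  by rewrite UEV' UAV' pencil_det_ublock rmorphM rootM rz.
pose T := dsubmx (invmx V' *m E1).
have E1V : E1 = V' *m col_mx 0 T.
  rewrite -[LHS](mulKVmx Vu'); congr (_ *m _).
  rewrite -[LHS]vsubmxK; congr (col_mx _ _).
  have : U' *m E *m V' *m (invmx V' *m E1) = 0.
    by rewrite mulmxA mulmxK // -mulmxA EE1 mulmx0.
  rewrite UEV' -[X in _ *m X]vsubmxK mul_block_col !mul0mx mul1mx !addr0.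
  by move=> /(congr1 usubmx); rewrite col_mxKu linear0.
have Tu : T \in unitmx.
  have E1free : row_free E1^T by rewrite /row_free mxrank_tr rE1.
  rewrite -unitmx_tr -row_free_unit; apply: inj_row_free => v vT.
  apply/eqP; rewrite -(mulmx_free_eq0 _ E1free) E1V trmx_mul tr_col_mx mulmxA.
  by rewrite mul_mx_row vT trmx0 mulmx0 row_mx0 mul0mx.
(* The block [1] keeps the matrix in the cone and is erased by [E^T]; in [Q], the factor [invmx T]
   undoes [E1] on the kernel of [E]. *)
exists (V' *m block_mx P 0 0 1%:M *m V'^T).
exists (invmx T *m row_mx 0 (- invmx D) *m (invmx U')^T); split.
  by apply: fposdef_congr => //; apply: fposdef_diag => //; apply: fposdef1.
have UTK : U'^T *m (invmx U')^T = 1%:M by rewrite -trmx_mul mulVmx // trmx1.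
have PE : V' *m block_mx P 0 0 1%:M *m V'^T *m E^T =
    V' *m block_mx P 0 0 0 *m (invmx U')^T.
  have UEVt : V'^T *m E^T *m U'^T = block_mx 1%:M 0 0 0.
    by rewrite -!trmx_mul mulmxA UEV' tr_block_mx !trmx0 trmx1.
  rewrite -[E^T]mulmx1 -UTK !mulmxA -(mulmxA _ V'^T) -(mulmxA _ (V'^T *m E^T)) UEVt.
  by rewrite -(mulmxA V') mulmx_block !(mulmx0, mul0mx, addr0, add0r, mulmx1).
have E1Q : E1 *m (invmx T *m row_mx 0 (- invmx D) *m (invmx U')^T) =
    V' *m block_mx 0 0 0 (- invmx D) *m (invmx U')^T.
  rewrite E1V !mulmxA; congr (_ *m _); rewrite -!mulmxA; congr (_ *m _).
  by rewrite mulmxA mul_col_mx mul0mx mulmxV // mul_col_row !mul0mx !mul1mx.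
rewrite PE E1Q -mulmxDl -mulmxDr add_block_mx !addr0 add0r.
have -> : A *m (V' *m block_mx P 0 0 (- invmx D) *m (invmx U')^T) =
    invmx U' *m block_mx (B *m P) 0 0 (- 1%:M) *m (invmx U')^T.
  rewrite !mulmxA; congr (_ *m _); apply: (canRL (mulKmx Uu')).
  rewrite !mulmxA UAV' mulmx_block !(mulmx0, mul0mx, addr0, add0r).
  by rewrite mulmxN mulmxV.
apply: negdef_msym_congr; first by rewrite unitmx_inv.
apply/negdef_msym => x; rewrite -[x]vsubmxK col_mx_neq0 bil_block.
rewrite !bil0mx addr0 add0r bilNmx.
have le0 v : bil (B *m P) v v <= 0 by have [->|/neg/ltW//] := eqVneq v 0; rewrite bil0r.
have ge0 (v : 'cV[R]_k) : 0 <= bil 1%:M v v.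
  by have [->|/bil1_gt0/ltW//] := eqVneq v 0; rewrite bil0r.
have := le0 (usubmx x); have := ge0 (dsubmx x).
by move=> ? ? /orP[/neg|/bil1_gt0]; lra.
Qed.

(** * State feedback and observers *)

Lemma unitmx_perturb (R : realType) (n : nat) (M D : 'M[R]_n) (e : R) :
  D \in unitmx -> 0 < e ->
  exists t, 0 < t < e /\ M + t *: (D - M) \in unitmx.
Proof.
(* The determinant along the segment is itself a pencil determinant, hence a polynomial in [t]; at
   [t = 1] it is [\det D], which is nonzero. *)
move=> Du e0; pose p := pencil_det (D - M) (- M).
have pE t : p.[t] = \det (M + t *: (D - M)).
  by rewrite pencil_det_horner opprK addrC.
have p0 : p != 0.
  apply: contraTneq Du => p0; rewrite unitmxE unitfE negbK -[D](subrK M) -[D - M]scale1r.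
  by rewrite addrC -pE p0 horner0.
(* [size p] distinct points, too many to be all roots of [p]; the denominators start at 2 to stay
   strictly below [e]. *)
pose rs := [seq e / j.+2%:R | j <- iota 0 (size p)].
have rs_uniq : uniq rs.
  rewrite map_inj_uniq ?iota_uniq // => i j /(mulfI (lt0r_neq0 e0)) /invr_inj.
  by move=> /eqP; rewrite eqr_nat => /eqP[].
have : ~~ all (root p) rs.
  apply/negP => rs_root; have := max_poly_roots p0 rs_root rs_uniq.
  by rewrite size_map size_iota ltnn.
rewrite -has_predC => /hasP[_ /mapP[j _ ->]] /= pt; exists (e / j.+2%:R); split.
  by rewrite divr_gt0 //= ltr_pdivrMr // ltr_pMr // ltr1n.
by rewrite unitmxE unitfE -pE.
Qed.

(** Taking [Q = E2] makes the matrix invertible, so moving slightly from [Q] towards [E2] reaches an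
    invertible one while the strict inequality persists. [G] stands for the term [B R1], which does
    not vary with [Q]. *)
Lemma lmi_unitmx (R : realType) (s c : R) (n k : nat) (E A G P : 'M[R]_n)
    (E1 : 'M_(n, k)) (E2 : 'M_(k, n)) Q :
  0 < s -> n = (\rank E + k)%N -> \rank E1 = k -> \rank E2 = k ->
  E *m E1 = 0 -> E2 *m E = 0 -> fposdef s c P ->
  negdef (msym (A *m (P *m E^T + E1 *m Q) + G)) ->
  exists Q', P *m E^T + E1 *m Q' \in unitmx /\
    negdef (msym (A *m (P *m E^T + E1 *m Q') + G)).
Proof.
move=> s0 nE rE1 rE2 EE1 E2E Pp /negdefN neg.
have E2ker : (kermx E <= E2)%MS.
  have sE2 : (E2 <= kermx E)%MS by rewrite sub_kermx E2E.
  by rewrite -(geq_leqif (mxrank_leqif_sup sE2)) mxrank_ker rE2 {1}nE addKn.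
(* Let [w] be a null column. Applying [E] gives [E P E^T w = 0], so [E^T w = 0] by positivity of
   [P]; then [E1 E2 w = 0] forces [E2 w = 0]. But [w^T] lies in the left kernel of [E], which the
   rows of [E2] span, so [w^T w = 0]. *)
have Du : P *m E^T + E1 *m E2 \in unitmx.
  rewrite -unitmx_tr -row_free_unit; apply: inj_row_free => v.
  move=> /(congr1 trmx); rewrite trmx_mul trmxK trmx0 mulmxDl => vD.
  have EPv : E *m P *m E^T *m v^T = 0.
    by have := congr1 (mulmx E) vD; rewrite mulmx0 mulmxDr !mulmxA EE1 !mul0mx addr0.
  have vE : v *m E = 0.
    apply/eqP; rewrite -(inj_eq trmx_inj) trmx0 trmx_mul; apply/negPn/negP.
    move=> /(fposdef_bil_gt0 s0 Pp); rewrite -bil_mulmx trmxK /bil trmxK.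
    by rewrite -(mulmxA v) EPv mulmx0 mxE ltxx.
  have /submxP[w vw] : (v <= E2)%MS.
    by apply: submx_trans E2ker; rewrite sub_kermx vE.
  have E2v : E2 *m v^T = 0.
    have E1free : row_free E1^T by rewrite /row_free mxrank_tr rE1.
    apply: trmx_inj; apply/eqP; rewrite trmx0 -(mulmx_free_eq0 _ E1free) -trmx_mul.
    apply/eqP/trmx_inj; rewrite trmxK trmx0 -vD -!mulmxA -trmx_mul vE.
    by rewrite trmx0 mulmx0 add0r.
  apply/eqP/negPn/negP; rewrite -(inj_eq trmx_inj) trmx0 => /bil1_gt0.
  by rewrite /bil mulmx1 trmxK {1}vw -mulmxA E2v mulmx0 mxE ltxx.
have [] := posdef_perturb (S := - msym (A *m (E1 *m (E2 - Q)))) neg.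
  by rewrite /msym linearN linearD /= trmxK addrC.
move=> e e0 pos; have [t [te Xu]] := unitmx_perturb (P *m E^T + E1 *m Q) Du e0.
have XE : P *m E^T + E1 *m Q + t *: (P *m E^T + E1 *m E2 - (P *m E^T + E1 *m Q)) =
    P *m E^T + E1 *m (Q + t *: (E2 - Q)).
  by rewrite opprD addrACA subrr add0r -mulmxBr mulmxDr -scalemxAr addrA.
exists (Q + t *: (E2 - Q)); split; first by rewrite -XE.
have -> : A *m (P *m E^T + E1 *m (Q + t *: (E2 - Q))) + G =
    A *m (P *m E^T + E1 *m Q) + G + t *: (A *m (E1 *m (E2 - Q))).
  by rewrite (mulmxDr E1 Q) -scalemxAr addrA [A *m (_ + t *: _)]mulmxDr -scalemxAr addrAC.
apply/negdefN; have := pos t te; congr posdef.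
set M := _ + G; set N := A *m (E1 *m (E2 - Q)); rewrite scalerN -opprD /msym.
by rewrite [(M + _)^T]linearD [X in _ = - (_ + X + _)]linearZ /= scalerDr addrACA.
Qed.

Lemma state_feedback (R : realType) (alpha : R) (n m k : nat) (E A P : 'M[R]_n)
    (B : 'M_(n, m)) (E1 : 'M_(n, k)) Q R1 :
  0 < alpha < 1 -> E *m E1 = 0 -> Palpha alpha P ->
  negdef (msym (A *m P *m E^T + A *m E1 *m Q + B *m R1)) ->
  P *m E^T + E1 *m Q \in unitmx ->
  admissible alpha E (A + B *m (R1 *m invmx (P *m E^T + E1 *m Q))).
Proof.
move=> a01 EE1 Pa neg Xu; apply: (lmi_admissible (Q := Q) a01 EE1 Pa).
by rewrite mulmxDl -!mulmxA mulVmx // mulmx1 mulmxDr !mulmxA.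
Qed.

(** The substitution [R1 = K (P E^T + E1 Q)] makes the inequality linear in the unknowns; undoing it
    requires an invertible factor, supplied by [lmi_unitmx]. *)
Lemma state_feedbackP (R : realType) (alpha : R) (n m k : nat) (E A : 'M[R]_n)
    (B : 'M_(n, m)) (E1 : 'M_(n, k)) (E2 : 'M_(k, n)) :
  0 < alpha < 1 -> n = (\rank E + k)%N -> \rank E1 = k -> \rank E2 = k ->
  E *m E1 = 0 -> E2 *m E = 0 ->
  (exists K, admissible alpha E (A + B *m K)) <->
  (exists P Q R1, Palpha alpha P /\
     negdef (msym (A *m P *m E^T + A *m E1 *m Q + B *m R1))).
Proof.
move=> a01 nE rE1 rE2 EE1 E2E; split=> [[K]|[P [Q [R1 [Pa neg]]]]].
  move=> /(admissible_lmi a01 nE rE1 EE1)[P [Q [Pa neg]]].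
  exists P, Q, (K *m (P *m E^T + E1 *m Q)); split=> //.
  by move: neg; rewrite mulmxDl mulmxDr !mulmxA.
have s0 : 0 < sin (alpha * pi / 2).
  by have := pi_gt0 R; case/andP: a01 => *; apply: sin_gt0_pi; nra.
have [] := lmi_unitmx (A := A) (G := B *m R1) (Q := Q) s0 nE rE1 rE2 EE1 E2E Pa.
  by rewrite mulmxDr !mulmxA.
move=> Q' [Xu]; rewrite mulmxDr !mulmxA => neg'.
by exists (R1 *m invmx (P *m E^T + E1 *m Q')); apply: state_feedback.
Qed.

(** * The observer-based closed loop *)

Unset Implicit Arguments.
Set Strict Implicit.

Theorem theorem2 (R : realType) (alpha : R) (n m p r : nat)
  (E A : 'M[R]_n) (B : 'M[R]_(n, m)) (C : 'M[R]_(p, n))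
  (E1 : 'M[R]_(n, n - r)) (E2 : 'M[R]_(n - r, n)) :
  0 < alpha < 1 ->
  \rank E = r -> (r < n)%N ->
  \rank E1 = (n - r)%N -> \rank E2 = (n - r)%N ->
  E *m E1 = 0 -> E2 *m E = 0 ->
  let Ebar := block_mx E 0 0 E in
  let Abar := fun (K : 'M[R]_(m, n)) (L : 'M[R]_(n, p)) =>
      block_mx (A + B *m K) (- (B *m K)) 0 (A + L *m C) in
  let LMIs := fun (P1 P2 : 'M[R]_n) (Q1 : 'M[R]_(n - r, n)) (Q2 : 'M[R]_(n, n - r))
                  (R1 : 'M[R]_(m, n)) (R2 : 'M[R]_(n, p)) =>
      [/\ Palpha alpha P1, Palpha alpha P2,
          negdef (msym (A *m P1 *m E^T + A *m E1 *m Q1 + B *m R1)) &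
          negdef (msym (E^T *m P2 *m A + Q2 *m E2 *m A + R2 *m C))] in
  ((exists (K : 'M[R]_(m, n)) (L : 'M[R]_(n, p)), admissible alpha Ebar (Abar K L))
    <->
   (exists P1 P2 Q1 Q2 R1 R2, LMIs P1 P2 Q1 Q2 R1 R2))
  /\
  (forall P1 P2 Q1 Q2 R1 R2, LMIs P1 P2 Q1 Q2 R1 R2 ->
     let X1 := P1 *m E^T + E1 *m Q1 in
     let X2 := E^T *m P2 + Q2 *m E2 in
     X1 \in unitmx -> X2 \in unitmx ->
     admissible alpha Ebar (Abar (R1 *m invmx X1) (invmx X2 *m R2))).
Proof.
move=> a01 rE ltrn rE1 rE2 EE1 E2E Ebar Abar LMIs.
have nE : n = (\rank E + (n - r))%N by rewrite rE subnKC // ltnW.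
have nEt : n = (\rank E^T + (n - r))%N by rewrite mxrank_tr.
have rE1t : \rank E1^T = (n - r)%N by rewrite mxrank_tr.
have rE2t : \rank E2^T = (n - r)%N by rewrite mxrank_tr.
have EE1t : E1^T *m E^T = 0 by rewrite -trmx_mul EE1 trmx0.
have E2Et : E^T *m E2^T = 0 by rewrite -trmx_mul E2E trmx0.
(* By transposition, [L^T] is a state-feedback gain for [(E^T, A^T, C^T)]. *)
have dualA L : admissible alpha E (A + L *m C) <->
    admissible alpha E^T (A^T + C^T *m L^T).
  by rewrite -[in X in _ <-> X]trmx_mul -linearD admissible_tr.
have dualN P Q S : negdef (msym (E^T *m P *m A + Q *m E2 *m A + S *m C)) =
    negdef (msym (A^T *m P^T *m E^T^T + A^T *m E2^T *m Q^T + C^T *m S^T)).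
  have -> : A^T *m P^T *m E^T^T + A^T *m E2^T *m Q^T + C^T *m S^T =
      (E^T *m P *m A + Q *m E2 *m A + S *m C)^T.
    by rewrite !linearD /= !trmx_mul !mulmxA.
  by rewrite /msym trmxK addrC.
have sf := state_feedbackP A B a01 nE rE1 rE2 EE1 E2E.
(* In the dual problem [E2^T] and [E1^T] exchange roles as right and left annihilators of [E^T]. *)
have sft := state_feedbackP A^T C^T a01 nEt rE2t rE1t E2Et EE1t.
split; last first.
  move=> P1 P2 Q1 Q2 R1 R2 [Pa1 Pa2 neg1 neg2] X1 X2 X1u X2u.
  apply/admissible_ublock; split; first exact: state_feedback.
  apply/dualA; rewrite dualN in neg2; rewrite trmx_mul trmx_inv.
  have X2E : X2^T = P2^T *m E^T^T + E2^T *m Q2^T by rewrite linearD /= !trmx_mul.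
  rewrite X2E; apply: state_feedback => //; first exact: fposdef_tr.
  by rewrite -X2E unitmx_tr.
split=> [[K [L /admissible_ublock[admK /dualA admL]]]|].
  have /sf[P1 [Q1 [R1 [Pa1 neg1]]]] : exists K, admissible alpha E (A + B *m K).
    by exists K.
  have /sft[P2 [Q2 [R2 [Pa2 neg2]]]] :
      exists K, admissible alpha E^T (A^T + C^T *m K) by exists L^T.
  exists P1, P2^T, Q1, Q2^T, R1, R2^T; split=> //; first exact: fposdef_tr.
  by move: neg2; rewrite dualN !trmxK.
(* The given solution may have singular [X1] or [X2], so the gains come from [sf] and [sft], not
   from the explicit formulas. *)
move=> [P1 [P2 [Q1 [Q2 [R1 [R2 [Pa1 Pa2 neg1 neg2]]]]]]].
have [K admK] : exists K, admissible alpha E (A + B *m K).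
  by apply/sf; exists P1, Q1, R1.
have [L admL] : exists K, admissible alpha E^T (A^T + C^T *m K).
  apply/sft; exists P2^T, Q2^T, R2^T; split; first exact: fposdef_tr.
  by rewrite -dualN.
exists K, L^T; apply/admissible_ublock; split=> //.
by apply/dualA; rewrite trmxK.
Qed.
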